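(* Let $(X,r)$ be a finite multipermutation solution of the YBE. If the structure group $G=G(X,r)$ is nilpotent (i.e. $(G,\circ)$ is a nilpotent group), then $\overline G=G/[G,G]_+$ is a trivial left brace. In particular, the image $(\overline X,\overline r)$ of $(X,r)$ in $(\overline G,r_{\overline G})$ is a trivial solution.
   Context: A solution of the YBE is a pair $(X,r)$ with $X$ a non-empty set and $r\colon X^2\to X^2$, $r(x,y)=(\lambda_x(y),\rho_y(x))$, a bijective map such that all $\lambda_x,\rho_y$ are bijective and $(r\times\mathrm{id})(\mathrm{id}\times r)(r\times\mathrm{id})=(\mathrm{id}\times r)(r\times\mathrm{id})(\mathrm{id}\times r)$ on $X^3$. It is finite if $X$ is finite, and trivial if $r(x,y)=(y,x)$ for all $x,y$. Retract and multipermutation solutions: define $x\sim y$ iff $\lambda_x=\lambda_y$ and $\rho_x=\rho_y$. Then $r$ induces a solution $(\overline x,\overline y)\mapsto(\overline{\lambda_x(y)},\overline{\rho_y(x)})$ of the YBE on $X/{\sim}$, denoted $\mathrm{Ret}(X,r)$. Put $\mathrm{Ret}^0(X,r)=(X,r)$ and $\mathrm{Ret}^n(X,r)=\mathrm{Ret}(\mathrm{Ret}^{n-1}(X,r))$. $(X,r)$ is a multipermutation solution if some $\mathrm{Ret}^m(X,r)$, $m\ge 0$, has exactly one element. A skew left brace is a set $B$ with two group structures $(B,+)$, $(B,\circ)$ such that $a\circ(b+c)=(a\circ b)-a+(a\circ c)$ for all $a,b,c$; it is a left brace if $(B,+)$ is abelian, and a trivial left brace if moreover $a+b=a\circ b$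 for all $a,b$. Its associated solution is $r_B(a,b)=(\lambda_a(b),\lambda_a(b)^{-1}\circ a\circ b)$ with $\lambda_a(b)=-a+a\circ b$. An ideal is a subset that is a normal subgroup of both $(B,+)$ and $(B,\circ)$ and is invariant under all $\lambda_a$; quotients by ideals are skew left braces. $G=G(X,r)$ is the group generated by $X$ with relations $x\circ y=\lambda_x(y)\circ\rho_y(x)$. $A_{\mathrm{gr}}(X,r)$ is the group, written additively, generated by $X$ with relations $x+\lambda_x(y)=\lambda_x(y)+\lambda_{\lambda_x(y)}(\rho_y(x))$. $G$ acts on $A_{\mathrm{gr}}(X,r)$ by automorphisms $\lambda^{e'}_g$, where $x\in X$ acts on generators as $\lambda_x$, and there is a bijective $1$-cocycle $\pi\colon G\to A_{\mathrm{gr}}(X,r)$, $\pi(g\circ h)=\pi(g)+\lambda^{e'}_g(\pi(h))$, that is the identity on generators. With $a+b=\pi^{-1}(\pi(a)+\pi(b))$, $(G,+,\circ)$ is a skew left brace. $[G,G]_+$ denotes the commutator subgroup of $(G,+)$; under the hypotheses of the claim it is an ideal of the skew left brace $G$, so that the quotient $\overline G$ makes sense as a skew left brace. $\overline X$ is the image of $X$ under $X\to G\to\overline G$ and $\overline r$ is the restriction of $r_{\overline G}$ to $\overline X^2$. *)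

(* Defs.v *)
From mathcomp Require Import all_boot generic_quotient.
From mathcomp Require Import boolp classical_sets.

Set Implicit Arguments.
Unset Strict Implicit.
Unset Printing Implicit Defensive.

Local Open Scope classical_set_scope.
Local Open Scope quotient_scope.

Section PropQuotient.
Variables (T : choiceType) (e : T -> T -> Prop).
Hypothesis e_refl : forall x, e x x.
Hypothesis e_sym : forall x y, e x y -> e y x.
Hypothesis e_trans : forall x y z, e x y -> e y z -> e x z.

Let eb : rel T := fun x y => `[< e x y >].

Lemma prop_equiv_refl : reflexive eb.
Proof. by move=> x; apply/asboolP. Qed.

Lemma prop_equiv_sym : symmetric eb.
Proof. by move=> x y; apply/asboolP/asboolP; apply: e_sym. Qed.

Lemma prop_equiv_trans : transitive eb.
Proof.
by move=> y x z /asboolP xy /asboolP yz; apply/asboolP; apply: e_trans xy yz.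
Qed.

Definition prop_equiv : equiv_rel T :=
  EquivRel eb prop_equiv_refl prop_equiv_sym prop_equiv_trans.

Lemma prop_equivP x y : prop_equiv x y <-> e x y.
Proof. by split=> /asboolP. Qed.

End PropQuotient.

(* r (x, y) = (lambda_x(y), rho_y(x)); note that rho takes y first. *)

Definition lam (X : Type) (r : X * X -> X * X) (x y : X) : X := (r (x, y)).1.
Definition rho (X : Type) (r : X * X -> X * X) (y x : X) : X := (r (x, y)).2.

Definition r_x_id (X : Type) (r : X * X -> X * X) (t : X * X * X) : X * X * X :=
  (r t.1, t.2).
Definition id_x_r (X : Type) (r : X * X -> X * X) (t : X * X * X) : X * X * X :=
  let s := r (t.1.2, t.2) in (t.1.1, s.1, s.2).

Record is_solution (X : Type) (r : X * X -> X * X) : Prop := IsSolution {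
  sol_nonempty : inhabited X;
  sol_bij : bijective r;
  sol_lam_bij : forall x, bijective (lam r x);
  sol_rho_bij : forall y, bijective (rho r y);
  sol_braid : forall t : X * X * X,
    r_x_id r (id_x_r r (r_x_id r t)) = id_x_r r (r_x_id r (id_x_r r t))
}.

Definition is_trivial_map (X : Type) (r : X * X -> X * X) : Prop :=
  forall x y, r (x, y) = (y, x).

Record finite_solution := FiniteSolution {
  sol_car :> finType;
  sol_map : sol_car * sol_car -> sol_car * sol_car;
  sol_prop : is_solution sol_map
}.

Section SolutionTheory.
Variables (X : Type) (r : X * X -> X * X).
Hypothesis rP : is_solution r.
Local Notation L := (lam r).
Local Notation R := (rho r).

Lemma sol_lam_inj x : injective (L x).
Proof. exact: bij_inj (sol_lam_bij rP x). Qed.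

Lemma sol_rho_inj y : injective (R y).
Proof. exact: bij_inj (sol_rho_bij rP y). Qed.

Lemma sol_YB1 x y z : L x (L y z) = L (L x y) (L (R y x) z).
Proof.
have /(congr1 (fun t => t.1.1)) := sol_braid rP (x, y, z).
by move/esym.
Qed.

Lemma sol_YB2 x y z : R (L (R y x) z) (L x y) = L (R (L y z) x) (R z y).
Proof.
have /(congr1 (fun t => t.1.2)) := sol_braid rP (x, y, z).
by [].
Qed.

Lemma sol_YB3 x y z : R z (R y x) = R (R z y) (R (L y z) x).
Proof.
have /(congr1 (fun t => t.2)) := sol_braid rP (x, y, z).
by [].
Qed.

End SolutionTheory.

Section Retract.
Variable S : finite_solution.
Local Notation r := (@sol_map S).
Local Notation L := (lam r).
Local Notation R := (rho r).
Let rP : is_solution r := sol_prop S.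

Definition ret_rel (x y : S) : Prop := L x =1 L y /\ R x =1 R y.

Lemma ret_rel_refl x : ret_rel x x. Proof. by []. Qed.

Lemma ret_rel_sym x y : ret_rel x y -> ret_rel y x.
Proof. by case=> h1 h2; split=> z; rewrite ?h1 ?h2. Qed.

Lemma ret_rel_trans x y z : ret_rel x y -> ret_rel y z -> ret_rel x z.
Proof. by case=> h1 h2 [h3 h4]; split=> t; rewrite ?h1 ?h2 ?h3 ?h4. Qed.

Definition ret_equiv : equiv_rel S :=
  prop_equiv ret_rel_refl ret_rel_sym ret_rel_trans.

Definition ret_car : finType := quot_type {eq_quot ret_equiv}.

Definition ret_pi (x : S) : ret_car :=
  \pi_{eq_quot ret_equiv} x.

Definition ret_repr (a : ret_car) : S :=
  repr (a : {eq_quot ret_equiv}).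

Lemma ret_reprK a : ret_pi (ret_repr a) = a.
Proof. exact: reprK. Qed.

Lemma ret_piP x y : ret_pi x = ret_pi y <-> ret_rel x y.
Proof.
split; first by move/eqmodP/prop_equivP.
by move=> h; apply/eqmodP/prop_equivP.
Qed.

(* The choice of representatives is immaterial: see ret_mapE. *)
Definition ret_map (p : ret_car * ret_car) : ret_car * ret_car :=
  let s := r (ret_repr p.1, ret_repr p.2) in (ret_pi s.1, ret_pi s.2).

Lemma ret_rel_lam x x' y y' :
  ret_rel x x' -> ret_rel y y' -> ret_rel (L x y) (L x' y').
Proof.
move=> [hx _] [ly ry]; rewrite -hx; split=> z.
  have [g gK Kg] := sol_lam_bij rP (R y x).
  rewrite -[z]Kg -(sol_YB1 rP); have -> : R y x = R y' x by rewrite /rho -/(R y x) ry.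
  by rewrite -(sol_YB1 rP) ly.
have [g gK Kg] := sol_rho_bij rP x.
rewrite -[z]Kg; set t := g z.
apply: (@sol_rho_inj _ _ rP (R y x)).
rewrite -(sol_YB3 rP) [R y x]ry -(sol_YB3 rP).
exact: ry.
Qed.

Lemma ret_rel_rho x x' y y' :
  ret_rel x x' -> ret_rel y y' -> ret_rel (R y x) (R y' x').
Proof.
move=> [lx rx] [_ ry]; rewrite -ry; split=> z.
  apply: (@sol_lam_inj _ _ rP (L x y)).
  by rewrite -(sol_YB1 rP) [L x y]lx -(sol_YB1 rP) lx.
have [g gK Kg] := sol_rho_bij rP (L x y).
rewrite -[z]Kg -(sol_YB3 rP) [L x y]lx -(sol_YB3 rP).
by rewrite rx.
Qed.

Lemma ret_mapE x y : ret_map (ret_pi x, ret_pi y) = (ret_pi (L x y), ret_pi (R y x)).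
Proof.
have hx : ret_rel (ret_repr (ret_pi x)) x by apply/ret_piP; rewrite ret_reprK.
have hy : ret_rel (ret_repr (ret_pi y)) y by apply/ret_piP; rewrite ret_reprK.
by rewrite /ret_map /=; congr (_, _); apply/ret_piP;
  [apply: ret_rel_lam | apply: ret_rel_rho].
Qed.

Lemma fin_surj_bij (T : finType) (f g : T -> T) : cancel g f -> bijective f.
Proof. by move=> gK; have := injF_bij (can_inj gK) => /bij_can_bij; apply. Qed.

Lemma ret_map_solution : is_solution ret_map.
Proof.
split.
- by have [x] := sol_nonempty rP; exists; exact: (ret_pi x).
- have [g gK Kg] := sol_bij rP.
  apply: (@fin_surj_bij _ _ (fun p =>
    let s := g (ret_repr p.1, ret_repr p.2) in (ret_pi s.1, ret_pi s.2))).
  case=> a b /=; rewrite ret_mapE /lam /rho -surjective_pairing Kg /=.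
  by rewrite !ret_reprK.
- move=> a; have [g gK Kg] := sol_lam_bij rP (ret_repr a).
  apply: (@fin_surj_bij _ _ (fun b => ret_pi (g (ret_repr b)))) => b.
  by rewrite -[a]ret_reprK /lam ret_mapE /= Kg ret_reprK.
- move=> a; have [g gK Kg] := sol_rho_bij rP (ret_repr a).
  apply: (@fin_surj_bij _ _ (fun b => ret_pi (g (ret_repr b)))) => b.
  by rewrite -[a]ret_reprK /rho ret_mapE /= Kg ret_reprK.
- case=> [[a b] c]; rewrite -[a]ret_reprK -[b]ret_reprK -[c]ret_reprK.
  move: (ret_repr a) (ret_repr b) (ret_repr c) => x y z.
  move: ret_map ret_mapE => f fE; rewrite /r_x_id /id_x_r /= !fE /=.
  by rewrite (sol_YB1 rP x y) (sol_YB2 rP x y) (sol_YB3 rP x y).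
Qed.

Definition retract : finite_solution := FiniteSolution ret_map_solution.

End Retract.

Definition multipermutation (S : finite_solution) : Prop :=
  exists m, #|iter m retract S| = 1%N.

(* Group structures as data on a type, since a skew left brace carries two. *)

Record group_law (T : Type) := GroupLaw {
  gop : T -> T -> T;
  gid : T;
  ginv : T -> T;
  gopA : forall x y z, gop x (gop y z) = gop (gop x y) z;
  gidl : forall x, gop gid x = x;
  ginvl : forall x, gop (ginv x) x = gid
}.

Section GroupTheory.
Variables (T : Type) (L : group_law T).
Local Notation "x * y" := (gop L x y).
Local Notation "1" := (gid L).
Local Notation "x ^-1" := (ginv L x).

Lemma ginvr x : x * x^-1 = 1.
Proof.
rewrite -[x * _](gidl L) -{1}(ginvl L x^-1) -(gopA L) (gopA L x^-1) (ginvl L).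
by rewrite (gidl L) (ginvl L).
Qed.

Lemma gidr x : x * 1 = x.
Proof. by rewrite -(ginvl L x) (gopA L) ginvr (gidl L). Qed.

Lemma gopVK x y : x^-1 * (x * y) = y.
Proof. by rewrite (gopA L) (ginvl L) (gidl L). Qed.

Lemma gopKV x y : x * (x^-1 * y) = y.
Proof. by rewrite (gopA L) ginvr (gidl L). Qed.

Lemma gop_injl x : injective (gop L x).
Proof. by move=> y z /(congr1 (gop L x^-1)); rewrite !gopVK. Qed.

Lemma ginv_uniq x y : x * y = 1 -> y = x^-1.
Proof. by move=> h; rewrite -(gopVK x y) h gidr. Qed.

Lemma ginvK x : x^-1^-1 = x.
Proof. by symmetry; apply: ginv_uniq; rewrite (ginvl L). Qed.

Lemma ginvM x y : (x * y)^-1 = y^-1 * x^-1.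
Proof.
by symmetry; apply: ginv_uniq; rewrite -(gopA L) gopKV ginvr.
Qed.

Definition subgroup (H : set T) : Prop :=
  [/\ H 1, forall x y, H x -> H y -> H (x * y) & forall x, H x -> H x^-1].

Definition normal_subgroup (H : set T) : Prop :=
  subgroup H /\ forall g h, H h -> H (g * h * g^-1).

Definition commutators (H K : set T) : set T :=
  smallest subgroup
    [set z | exists x y, [/\ H x, K y & z = x * y * x^-1 * y^-1]].

(* lower_central n is the (n+1)-st term of the lower central series *)
Definition lower_central (n : nat) : set T :=
  iter n (fun H => commutators H setT) setT.

Definition nilpotent_law : Prop := exists n, lower_central n = [set 1].

End GroupTheory.

(* Groups given by generators and relations.  A word is a sequence of letters
   (true, x), standing for x, and (false, x), standing for the inverse of x. *)

Definition word (X : Type) := seq (bool * X).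

Section Presentation.
Variables (X : choiceType) (R : word X -> word X -> Prop).

Inductive pres_eq : word X -> word X -> Prop :=
| pres_refl u : pres_eq u u
| pres_sym u v : pres_eq u v -> pres_eq v u
| pres_trans u v w : pres_eq u v -> pres_eq v w -> pres_eq u w
| pres_cat u u' v v' : pres_eq u u' -> pres_eq v v' -> pres_eq (u ++ v) (u' ++ v')
| pres_cancel b x : pres_eq [:: (b, x); (~~ b, x)] [::]
| pres_relator u v : R u v -> pres_eq u v.

Definition pres_equiv : equiv_rel (word X) :=
  prop_equiv pres_refl pres_sym pres_trans.

Definition pres : choiceType := {eq_quot pres_equiv}.
Definition pres_pi (w : word X) : pres := \pi_{eq_quot pres_equiv} w.
Definition pres_repr (a : pres) : word X := repr (a : {eq_quot pres_equiv}).
Definition pres_gen (x : X) : pres := pres_pi [:: (true, x)].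

Lemma pres_reprK a : pres_pi (pres_repr a) = a.
Proof. exact: reprK. Qed.

Lemma pres_piP u v : pres_pi u = pres_pi v <-> pres_eq u v.
Proof.
split; first by move/eqmodP/prop_equivP.
by move=> h; apply/eqmodP/prop_equivP.
Qed.

Lemma pres_repr_pi w : pres_eq (pres_repr (pres_pi w)) w.
Proof. by apply/pres_piP; rewrite pres_reprK. Qed.

Definition word_inv (w : word X) : word X := rev [seq (~~ l.1, l.2) | l <- w].

Definition pres_op (a b : pres) : pres := pres_pi (pres_repr a ++ pres_repr b).
Definition pres_inv (a : pres) : pres := pres_pi (word_inv (pres_repr a)).

Lemma pres_opE u v : pres_op (pres_pi u) (pres_pi v) = pres_pi (u ++ v).
Proof. by apply/pres_piP; apply: pres_cat; apply: pres_repr_pi. Qed.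

Lemma pres_opA a b c : pres_op a (pres_op b c) = pres_op (pres_op a b) c.
Proof.
by rewrite -[a]pres_reprK -[b]pres_reprK -[c]pres_reprK !pres_opE catA.
Qed.

Lemma pres_idl a : pres_op (pres_pi [::]) a = a.
Proof. by rewrite -[a]pres_reprK pres_opE. Qed.

Lemma word_invl w : pres_eq (word_inv w ++ w) [::].
Proof.
elim: w => [|[b x] w IH]; first exact: pres_refl.
rewrite /word_inv /= rev_cons -cats1 -catA /=; apply: pres_trans IH.
rewrite -/(word_inv w); apply: pres_cat; first exact: pres_refl.
rewrite -[_ :: _ :: w]/([:: (~~ b, x); (b, x)] ++ w) -[X in pres_eq _ X]cat0s.
apply: pres_cat; last exact: pres_refl.
by rewrite -{2}[b]negbK; apply: pres_cancel.
Qed.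

Lemma pres_invl a : pres_op (pres_inv a) a = pres_pi [::].
Proof.
by rewrite -{2}[a]pres_reprK /pres_inv pres_opE; apply/pres_piP/word_invl.
Qed.

Definition pres_law : group_law pres := GroupLaw pres_opA pres_idl pres_invl.

End Presentation.

Record skew_brace := SkewBrace {
  sb_car :> choiceType;
  sb_add : group_law sb_car;
  sb_circ : group_law sb_car;
  sb_ax : forall a b c : sb_car,
    gop sb_circ a (gop sb_add b c) =
    gop sb_add (gop sb_add (gop sb_circ a b) (ginv sb_add a)) (gop sb_circ a c)
}.

Definition left_brace (B : skew_brace) : Prop :=
  forall a b : B, gop (sb_add B) a b = gop (sb_add B) b a.

Definition trivial_left_brace (B : skew_brace) : Prop :=
  left_brace B /\ forall a b : B, gop (sb_add B) a b = gop (sb_circ B) a b.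

Section SkewBraceTheory.
Variable B : skew_brace.
Local Notation "x + y" := (gop (sb_add B) x y).
Local Notation "- x" := (ginv (sb_add B) x).
Local Notation "0" := (gid (sb_add B)).
Local Notation "x * y" := (gop (sb_circ B) x y).
Local Notation "x ^-1" := (ginv (sb_circ B) x).

Definition sb_lam (a b : B) : B := - a + a * b.

(* the associated solution r_B *)
Definition sb_map (p : B * B) : B * B :=
  let: (a, b) := p in (sb_lam a b, (sb_lam a b)^-1 * a * b).

Definition ideal (I : set B) : Prop :=
  [/\ normal_subgroup (sb_add B) I, normal_subgroup (sb_circ B) I
    & forall a b, I b -> I (sb_lam a b)].

Lemma sb_id : gid (sb_circ B) = 0.
Proof.
have := sb_ax (gid (sb_circ B)) 0 0; rewrite !(gidl (sb_circ B)) !(gidl (sb_add B)).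
rewrite gidr => E.
by rewrite -[LHS](ginvK (sb_add B)) -E; apply/esym/ginv_uniq; rewrite (gidl (sb_add B)).
Qed.

Lemma sb_lamE a b : a * b = a + sb_lam a b.
Proof. by rewrite /sb_lam gopKV. Qed.

Lemma sb_lamM a b c : sb_lam (a * b) c = sb_lam a (sb_lam b c).
Proof.
have : a * (b + sb_lam b c) = a * b + sb_lam (a * b) c.
  by rewrite -!sb_lamE (gopA (sb_circ B)).
by rewrite sb_ax -(gopA (sb_add B)) => /(@gop_injl _ (sb_add B)) <-.
Qed.

Lemma sb_lam1 c : sb_lam 0 c = c.
Proof. by rewrite /sb_lam -{2}sb_id (gidl (sb_circ B)) -[X in _ + X](gidl (sb_add B)) gopVK. Qed.

Section Quotient.
Variables (I : set B) (idI : ideal I).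

Definition coset_rel (a b : B) : Prop := I (- a + b).

Lemma coset_refl a : coset_rel a a.
Proof. by rewrite /coset_rel (ginvl (sb_add B)); case: idI => [[[]]]. Qed.

Lemma coset_sym a b : coset_rel a b -> coset_rel b a.
Proof.
case: idI => [[[_ _ IV] _] _ _] /IV; rewrite ginvM ginvK; exact.
Qed.

Lemma coset_trans a b c : coset_rel a b -> coset_rel b c -> coset_rel a c.
Proof.
case: idI => [[[_ ID _] _] _ _] ab bc; have := ID _ _ ab bc.
by rewrite -(gopA (sb_add B)) gopKV.
Qed.

Lemma coset_circ a b : coset_rel a b <-> I (a^-1 * b).
Proof.
case: idI => _ _ IL; have E : - a + b = sb_lam a (a^-1 * b).
  by rewrite /sb_lam gopKV.
rewrite /coset_rel E; split; last exact: IL.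
by move=> /(IL a^-1); rewrite -sb_lamM (ginvl (sb_circ B)) sb_id sb_lam1.
Qed.

Lemma normal_op (L : group_law B) : normal_subgroup L I ->
  forall a a' b b', I (gop L (ginv L a) a') -> I (gop L (ginv L b) b') ->
  I (gop L (ginv L (gop L a b)) (gop L a' b')).
Proof.
move=> [[_ ID _] IN] a a' b b' ha hb.
have := ID _ _ (IN (ginv L b) _ ha) hb.
by rewrite ginvK ginvM -!(gopA L) gopKV.
Qed.

Lemma normal_inv (L : group_law B) : normal_subgroup L I ->
  forall a a', I (gop L (ginv L a) a') ->
  I (gop L (ginv L (ginv L a)) (ginv L a')).
Proof.
move=> [[_ _ IV] IN] a a' /IV /(IN a).
by rewrite ginvM !ginvK -!(gopA L) ginvr gidr.
Qed.

Definition quot_equiv : equiv_rel B := prop_equiv coset_refl coset_sym coset_trans.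
Definition quot_car : choiceType := {eq_quot quot_equiv}.
Definition quot_pi (a : B) : quot_car := \pi_{eq_quot quot_equiv} a.
Definition quot_repr (x : quot_car) : B := repr (x : {eq_quot quot_equiv}).

Lemma quot_reprK x : quot_pi (quot_repr x) = x.
Proof. exact: reprK. Qed.

Lemma quot_piP a b : quot_pi a = quot_pi b <-> coset_rel a b.
Proof.
split; first by move/eqmodP/prop_equivP.
by move=> h; apply/eqmodP/prop_equivP.
Qed.

Lemma quot_repr_pi a : coset_rel (quot_repr (quot_pi a)) a.
Proof. by apply/quot_piP; rewrite quot_reprK. Qed.

Section QuotientLaw.
Variable L : group_law B.
Hypothesis L_op : forall a a' b b',
  coset_rel a a' -> coset_rel b b' -> coset_rel (gop L a b) (gop L a' b').
Hypothesis L_inv : forall a a',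
  coset_rel a a' -> coset_rel (ginv L a) (ginv L a').

Definition quot_op (x y : quot_car) := quot_pi (gop L (quot_repr x) (quot_repr y)).
Definition quot_inv (x : quot_car) := quot_pi (ginv L (quot_repr x)).

Lemma quot_opE a b : quot_op (quot_pi a) (quot_pi b) = quot_pi (gop L a b).
Proof. by apply/quot_piP; apply: L_op; apply: quot_repr_pi. Qed.

Lemma quot_invE a : quot_inv (quot_pi a) = quot_pi (ginv L a).
Proof. by apply/quot_piP; apply: L_inv; apply: quot_repr_pi. Qed.

Lemma quot_opA x y z : quot_op x (quot_op y z) = quot_op (quot_op x y) z.
Proof.
by rewrite -[x]quot_reprK -[y]quot_reprK -[z]quot_reprK !quot_opE (gopA L).
Qed.

Lemma quot_idl x : quot_op (quot_pi (gid L)) x = x.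
Proof. by rewrite -[x]quot_reprK quot_opE (gidl L). Qed.

Lemma quot_invl x : quot_op (quot_inv x) x = quot_pi (gid L).
Proof. by rewrite -[x]quot_reprK quot_invE quot_opE (ginvl L). Qed.

Definition quot_law : group_law quot_car := GroupLaw quot_opA quot_idl quot_invl.

End QuotientLaw.

Lemma coset_add_op a a' b b' :
  coset_rel a a' -> coset_rel b b' -> coset_rel (a + b) (a' + b').
Proof. by case: idI => nI _ _; apply: normal_op. Qed.

Lemma coset_add_inv a a' : coset_rel a a' -> coset_rel (- a) (- a').
Proof. by case: idI => nI _ _; apply: normal_inv. Qed.

Lemma coset_circ_op a a' b b' :
  coset_rel a a' -> coset_rel b b' -> coset_rel (a * b) (a' * b').
Proof. by rewrite !coset_circ; case: idI => _ nI _; apply: normal_op. Qed.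

Lemma coset_circ_inv a a' : coset_rel a a' -> coset_rel a^-1 a'^-1.
Proof. by rewrite !coset_circ; case: idI => _ nI _; apply: normal_inv. Qed.

Definition quot_add := quot_law coset_add_op coset_add_inv.
Definition quot_circ := quot_law coset_circ_op coset_circ_inv.

Lemma quot_ax x y z :
  gop quot_circ x (gop quot_add y z) =
  gop quot_add (gop quot_add (gop quot_circ x y) (ginv quot_add x)) (gop quot_circ x z).
Proof.
rewrite -[x]quot_reprK -[y]quot_reprK -[z]quot_reprK /=.
have oA := quot_opE coset_add_op; have oC := quot_opE coset_circ_op.
by rewrite (quot_invE coset_add_inv) !(oA, oC) sb_ax.
Qed.

Definition quot_brace : skew_brace := SkewBrace quot_ax.

Lemma quot_addE a b :
  gop (sb_add quot_brace) (quot_pi a) (quot_pi b) = quot_pi (a + b).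
Proof. exact: (quot_opE coset_add_op). Qed.

Lemma quot_oppE a : ginv (sb_add quot_brace) (quot_pi a) = quot_pi (- a).
Proof. exact: (quot_invE coset_add_inv). Qed.

Lemma quot_circE a b :
  gop (sb_circ quot_brace) (quot_pi a) (quot_pi b) = quot_pi (a * b).
Proof. exact: (quot_opE coset_circ_op). Qed.

Lemma quot_circVE a : ginv (sb_circ quot_brace) (quot_pi a) = quot_pi a^-1.
Proof. exact: (quot_invE coset_circ_inv). Qed.

End Quotient.
End SkewBraceTheory.

Section StructureGroup.
Variable S : finite_solution.
Local Notation r := (@sol_map S).
Local Notation L := (lam r).
Local Notation R := (rho r).
Let rP : is_solution r := sol_prop S.

(* the relations x o y = lambda_x(y) o rho_y(x) *)
Definition G_rel (u v : word S) : Prop := exists x y : S,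
  u = [:: (true, x); (true, y)] /\ v = [:: (true, L x y); (true, R y x)].

(* the relations x + lambda_x(y) = lambda_x(y) + lambda_(lambda_x(y))(rho_y(x)) *)
Definition A_rel (u v : word S) : Prop := exists x y : S,
  u = [:: (true, x); (true, L x y)] /\
  v = [:: (true, L x y); (true, L (L x y) (R y x))].

Definition G_car : choiceType := pres G_rel.
Definition G_law : group_law G_car := pres_law G_rel.
Definition G_gen : S -> G_car := pres_gen G_rel.

Definition A_car : choiceType := pres A_rel.
Definition A_law : group_law A_car := pres_law A_rel.
Definition A_gen : S -> A_car := pres_gen A_rel.

Lemma G_opE u v : gop G_law (pres_pi G_rel u) (pres_pi G_rel v) = pres_pi G_rel (u ++ v).
Proof. exact: pres_opE. Qed.

Lemma A_opE u v : gop A_law (pres_pi A_rel u) (pres_pi A_rel v) = pres_pi A_rel (u ++ v).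
Proof. exact: pres_opE. Qed.

Definition lamV (x : S) : S -> S := finv (L x).

Lemma lamVK x : cancel (lamV x) (L x).
Proof. exact/f_finv/sol_lam_inj. Qed.

Lemma lamKV x : cancel (L x) (lamV x).
Proof. exact/finv_f/sol_lam_inj. Qed.

Definition diag (x : S) : S := lamV x x.

Lemma diag_inj : injective diag.
Proof.
suff key y : R (diag y) y = L (diag y) (R (diag (diag y)) (diag y)).
  by move=> y z E; have := key y; rewrite E -key => /(sol_rho_inj rP).
set x := diag y; set t := diag x.
have xE : L y x = y by apply: lamVK.
have tE : L x t = x by apply: lamVK.
have lE z : L (R x y) z = L x z.
  by apply: (@sol_lam_inj _ _ rP y); rewrite {1}(sol_YB1 rP y x) xE.
by have := sol_YB2 rP y x t; rewrite tE xE !lE tE.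
Qed.

Definition diagV : S -> S := finv diag.

Lemma diagK : cancel diag diagV.
Proof. exact/finv_f/diag_inj. Qed.

Lemma diagVK : cancel diagV diag.
Proof. exact/f_finv/diag_inj. Qed.

(* The permutation of X by which a word acts, and the map induced on words by
   a map of generators. *)
Definition letter_act (l : bool * S) : S -> S := if l.1 then L l.2 else lamV l.2.
Definition word_act (w : word S) (y : S) : S := foldr letter_act y w.
Definition word_map (f : S -> S) (w : word S) : word S :=
  [seq (l.1, f l.2) | l <- w].

(* On words, the cocycle is pi(x o h) = x + lambda_x(pi(h)) and
   pi(x^-1 o h) = - lambda_x^-1(x) + lambda_x^-1(pi(h)). *)
Fixpoint word_pi (w : word S) : word S :=
  if w is l :: w' then
    (l.1, if l.1 then l.2 else diag l.2) :: word_map (letter_act l) (word_pi w')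
  else [::].

(* word_piV f w is the inverse image under word_pi of word_map f w.  A letter
   - x is the image of the inverse of the generator z with lambda_z^-1(z) = x. *)
Fixpoint word_piV (f : S -> S) (w : word S) : word S :=
  if w is (b, x) :: w' then
    let z := if b then f x else diagV (f x) in
    (b, z) :: word_piV ((if b then lamV z else L z) \o f) w'
  else [::].

Definition G_act (g : G_car) (a : A_car) : A_car :=
  pres_pi A_rel (word_map (word_act (pres_repr g)) (pres_repr a)).

Definition cocycle (g : G_car) : A_car := pres_pi A_rel (word_pi (pres_repr g)).
Definition cocycleV (a : A_car) : G_car :=
  pres_pi G_rel (word_piV id (pres_repr a)).

Lemma letter_actK b x : cancel (letter_act (b, x)) (letter_act (~~ b, x)).
Proof. by case: b => y; [apply: lamKV | apply: lamVK]. Qed.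

Lemma word_act_cat u v y : word_act (u ++ v) y = word_act u (word_act v y).
Proof. exact: foldr_cat. Qed.

Lemma word_act_inj w : injective (word_act w).
Proof.
elim: w => [|[b x] w IH] y z //= /(can_inj (letter_actK b x)); exact: IH.
Qed.

Lemma word_act_eq u v : pres_eq G_rel u v -> word_act u =1 word_act v.
Proof.
elim=> {u v} //.
- by move=> u v _ IH y; rewrite IH.
- by move=> u v w _ IH1 _ IH2 y; rewrite IH1.
- by move=> u u' v v' _ IH1 _ IH2 y; rewrite !word_act_cat IH1 IH2.
- by move=> b x y; rewrite -{1}[b]negbK /word_act /= letter_actK.
- by move=> _ _ [x [y [-> ->]]] z; apply: (sol_YB1 rP).
Qed.

Lemma word_map_cat f u v : word_map f (u ++ v) = word_map f u ++ word_map f v.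
Proof. exact: map_cat. Qed.

Lemma word_map_comp f g w : word_map f (word_map g w) = word_map (f \o g) w.
Proof. by rewrite /word_map -map_comp. Qed.

Lemma word_map_id f w : f =1 id -> word_map f w = w.
Proof. by move=> fE; elim: w => [|[b x] w IH] //=; rewrite fE IH. Qed.

Lemma eq_word_map f g w : f =1 g -> word_map f w = word_map g w.
Proof. by move=> fE; apply: eq_map => l; rewrite fE. Qed.

(* maps of X compatible with the relations of A *)
Definition A_compat (f : S -> S) : Prop :=
  forall x y, exists x' y', [/\ f x = x', f (L x y) = L x' y' &
    f (L (L x y) (R y x)) = L (L x' y') (R y' x')].

Lemma A_compat_lam u : A_compat (L u).
Proof.
move=> x y; exists (L u x), (L (R x u) y); split=> //.
  exact: (sol_YB1 rP).
by rewrite (sol_YB2 rP) -!(sol_YB1 rP).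
Qed.

Lemma A_compat_lamV u : A_compat (lamV u).
Proof.
move=> x y; pose x0 := lamV u x; pose y0 := lamV (R x0 u) y.
exists x0, y0; split=> //.
  by apply: (@sol_lam_inj _ _ rP u); rewrite lamVK (sol_YB1 rP) !lamVK.
apply: (@sol_lam_inj _ _ rP u); rewrite lamVK.
rewrite (sol_YB1 rP u) (sol_YB1 rP u x0) -/x0.
rewrite -(sol_YB2 rP) !lamVK.
by [].
Qed.

Lemma A_compat_comp f g : A_compat f -> A_compat g -> A_compat (f \o g).
Proof.
move=> hf hg x y; have [x' [y' [gx gy gz]]] := hg x y.
have [x2 [y2 [fx fy fz]]] := hf x' y'.
by exists x2, y2; rewrite /= gx gy gz.
Qed.

Lemma A_compat_id : A_compat id.
Proof. by move=> x y; exists x, y. Qed.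

Lemma A_compat_act w : A_compat (word_act w).
Proof.
elim: w => [|[b x] w IH]; first exact: A_compat_id.
apply: (A_compat_comp (f := letter_act (b, x))) => //.
by case: b; [apply: A_compat_lam | apply: A_compat_lamV].
Qed.

Lemma word_map_eq f u v : A_compat f ->
  pres_eq A_rel u v -> pres_eq A_rel (word_map f u) (word_map f v).
Proof.
move=> hf; elim=> {u v}.
- by move=> u; apply: pres_refl.
- by move=> u v _; apply: pres_sym.
- by move=> u v w _ IH1 _; apply: pres_trans IH1.
- by move=> u u' v v' _ IH1 _ IH2; rewrite !word_map_cat; apply: pres_cat.
- by move=> b x; apply: pres_cancel.
- move=> _ _ [x [y [-> ->]]]; apply: pres_relator.
  have [x' [y' [fx fy fz]]] := hf x y.
  by exists x', y'; rewrite /= fx fy fz.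
Qed.

Lemma G_actE w a : G_act (pres_pi G_rel w) (pres_pi A_rel a) =
  pres_pi A_rel (word_map (word_act w) a).
Proof.
rewrite /G_act (eq_word_map _ (word_act_eq (pres_repr_pi G_rel w))).
by apply/pres_piP/word_map_eq/pres_repr_pi/A_compat_act.
Qed.

Lemma word_pi_cat u v :
  word_pi (u ++ v) = word_pi u ++ word_map (word_act u) (word_pi v).
Proof.
elim: u => [|l u IH] /=; first by rewrite word_map_id.
by rewrite IH word_map_cat word_map_comp.
Qed.

Lemma word_pi_eq u v :
  pres_eq G_rel u v -> pres_eq A_rel (word_pi u) (word_pi v).
Proof.
elim=> {u v}.
- by move=> u; apply: pres_refl.
- by move=> u v _; apply: pres_sym.
- by move=> u v w _ IH1 _; apply: pres_trans IH1.
- move=> u u' v v' hu IH1 _ IH2; rewrite !word_pi_cat; apply: pres_cat => //.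
  rewrite (eq_word_map _ (word_act_eq hu)).
  exact/word_map_eq/IH2/A_compat_act.
- case=> x /=; rewrite /letter_act /=.
    by rewrite lamVK; apply: (pres_cancel _ true).
  exact: (pres_cancel _ false).
- by move=> _ _ [x [y [-> ->]]]; apply: pres_relator; exists x, y.
Qed.

Lemma cocycleE w : cocycle (pres_pi G_rel w) = pres_pi A_rel (word_pi w).
Proof. exact/pres_piP/word_pi_eq/pres_repr_pi. Qed.

Lemma eq_word_piV f g w : f =1 g -> word_piV f w = word_piV g w.
Proof.
elim: w f g => [|[b x] w IH] f g fE //=; rewrite fE; congr (_ :: _).
by apply: IH => y /=; rewrite fE.
Qed.

Lemma word_piV_map f g w : word_piV f (word_map g w) = word_piV (f \o g) w.
Proof. by elim: w f g => [|[b x] w IH] f g //=; rewrite IH. Qed.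

Lemma word_piK f w : f =1 id -> word_piV f (word_pi w) = w.
Proof.
elim: w f => [|[b x] w IH] f fE //=; rewrite fE word_piV_map.
have -> : (if b then if b then x else diag x else diagV (if b then x else diag x)) = x.
  by case: (b) => //; rewrite diagK.
rewrite IH //; case: (b) => y /=; rewrite fE /letter_act /=.
  exact: lamKV.
exact: lamVK.
Qed.

Lemma word_piVK f w : word_pi (word_piV f w) = word_map f w.
Proof.
elim: w f => [|[b x] w IH] f //=; rewrite IH word_map_comp.
case: b => /=; first by congr (_ :: _); apply: eq_word_map => y /=; rewrite /letter_act /= lamVK.
rewrite diagVK; congr (_ :: _); apply: eq_word_map => y /=.
by rewrite /letter_act /= lamKV.
Qed.

(* the map by which word_piV f acts beyond the prefix u *)
Fixpoint word_end (f : S -> S) (u : word S) : S -> S :=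
  if u is (b, x) :: u' then
    let z := if b then f x else diagV (f x) in
    word_end ((if b then lamV z else L z) \o f) u'
  else f.

Lemma word_piV_cat f u v :
  word_piV f (u ++ v) = word_piV f u ++ word_piV (word_end f u) v.
Proof. by elim: u f => [|[b x] u IH] f //=; rewrite IH. Qed.

Lemma word_endE f u y : word_act (word_piV f u) (word_end f u y) = f y.
Proof.
elim: u f => [|[b x] u IH] f //=; rewrite IH /letter_act.
by case: b => /=; rewrite ?lamVK ?lamKV.
Qed.

Lemma word_end_compat f u : A_compat f -> A_compat (word_end f u).
Proof.
elim: u f => [|[b x] u IH] f hf //=; apply: IH; apply: A_compat_comp hf.
by case: b; [apply: A_compat_lamV | apply: A_compat_lam].
Qed.

Lemma word_piV_eq u v : pres_eq A_rel u v ->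
  forall f, A_compat f -> pres_eq G_rel (word_piV f u) (word_piV f v).
Proof.
elim=> {u v}.
- by move=> u f _; apply: pres_refl.
- by move=> u v _ IH f hf; apply/pres_sym/IH.
- by move=> u v w _ IH1 _ IH2 f hf; apply: pres_trans (IH1 f hf) (IH2 f hf).
- move=> u u' v v' hu IH1 _ IH2 f hf; rewrite !word_piV_cat.
  apply: pres_cat; first exact: IH1.
  have E : word_end f u =1 word_end f u'.
    move=> y; apply: (@word_act_inj (word_piV f u)).
    by rewrite word_endE (word_act_eq (IH1 f hf)) word_endE.
  by rewrite (eq_word_piV _ E); apply/IH2/word_end_compat.
- case=> x f hf /=.
    by rewrite -/(diag (f x)) diagK; apply: (pres_cancel _ true).
  set z := diagV (f x); have -> : L z (f x) = z.
    by rewrite -[f x]diagVK -/z; apply: lamVK.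
  exact: (pres_cancel _ false).
- move=> _ _ [x [y [-> ->]]] f hf; apply: pres_relator.
  have [x' [y' [fx fy fz]]] := hf x y.
  by exists x', y'; rewrite /= fx fy fz !lamKV.
Qed.

Lemma cocycleVE w : cocycleV (pres_pi A_rel w) = pres_pi G_rel (word_piV id w).
Proof. by apply/pres_piP/word_piV_eq/A_compat_id/pres_repr_pi. Qed.

Lemma cocycleK : cancel cocycle cocycleV.
Proof.
by move=> g; rewrite -[g]pres_reprK cocycleE cocycleVE word_piK.
Qed.

Lemma cocycleVK : cancel cocycleV cocycle.
Proof.
by move=> a; rewrite -[a]pres_reprK cocycleVE cocycleE word_piVK word_map_id.
Qed.

(* G_act is the action by automorphisms extending x |-> lambda_x, and cocycle
   is the bijective 1-cocycle that is the identity on generators. *)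

Lemma G_act_gen x y : G_act (G_gen x) (A_gen y) = A_gen (L x y).
Proof. exact: G_actE. Qed.

Lemma G_actD g a b : G_act g (gop A_law a b) = gop A_law (G_act g a) (G_act g b).
Proof.
rewrite -[g]pres_reprK -[a]pres_reprK -[b]pres_reprK A_opE !G_actE.
by rewrite A_opE word_map_cat.
Qed.

Lemma G_actM g h a : G_act (gop G_law g h) a = G_act g (G_act h a).
Proof.
rewrite -[g]pres_reprK -[h]pres_reprK -[a]pres_reprK G_opE !G_actE.
by rewrite word_map_comp; congr pres_pi; apply: eq_word_map => y; rewrite word_act_cat.
Qed.

Lemma G_act1 a : G_act (gid G_law) a = a.
Proof. by rewrite -[a]pres_reprK G_actE word_map_id. Qed.

Lemma cocycle_gen x : cocycle (G_gen x) = A_gen x.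
Proof. exact: cocycleE. Qed.

Lemma cocycleM g h :
  cocycle (gop G_law g h) = gop A_law (cocycle g) (G_act g (cocycle h)).
Proof.
rewrite -[g]pres_reprK -[h]pres_reprK G_opE !cocycleE G_actE A_opE.
by rewrite word_pi_cat.
Qed.

(* the additive structure a + b = pi^-1(pi(a) + pi(b)) on G *)

Definition G_plus (a b : G_car) : G_car :=
  cocycleV (gop A_law (cocycle a) (cocycle b)).
Definition G_zero : G_car := cocycleV (gid A_law).
Definition G_opp (a : G_car) : G_car := cocycleV (ginv A_law (cocycle a)).

Lemma G_plusA a b c : G_plus a (G_plus b c) = G_plus (G_plus a b) c.
Proof. by rewrite /G_plus !cocycleVK (gopA A_law). Qed.

Lemma G_zerol a : G_plus G_zero a = a.
Proof. by rewrite /G_plus cocycleVK (gidl A_law) cocycleK. Qed.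

Lemma G_oppl a : G_plus (G_opp a) a = G_zero.
Proof. by rewrite /G_plus cocycleVK (ginvl A_law). Qed.

Definition G_add : group_law G_car := GroupLaw G_plusA G_zerol G_oppl.

Lemma cocycleD a b : cocycle (gop G_add a b) = gop A_law (cocycle a) (cocycle b).
Proof. exact: cocycleVK. Qed.

Lemma G_brace_ax a b c :
  gop G_law a (gop G_add b c) =
  gop G_add (gop G_add (gop G_law a b) (ginv G_add a)) (gop G_law a c).
Proof.
apply: (can_inj cocycleK).
rewrite cocycleM [gop G_add _ _]/(G_plus _ _) /= /G_plus /G_opp !cocycleVK.
rewrite -!/(gop A_law _ _) -!/(gop G_law _ _) !cocycleM G_actD.
by rewrite -!(gopA A_law) gopVK.
Qed.

Definition structure_brace : skew_brace := SkewBrace G_brace_ax.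

(* the commutator subgroup of (G, +) *)
Definition comm_add : set structure_brace :=
  commutators (sb_add structure_brace) setT setT.

Lemma G_lam_gen x y :
  sb_lam (B := structure_brace) (G_gen x) (G_gen y) = G_gen (L x y).
Proof.
apply: (@gop_injl _ (sb_add structure_brace) (G_gen x)).
rewrite -sb_lamE; apply: (can_inj cocycleK).
rewrite [gop (sb_circ _) _ _]/(gop G_law _ _) cocycleM !cocycle_gen G_act_gen.
by rewrite [gop (sb_add _) _ _]/(gop G_add _ _) cocycleD !cocycle_gen.
Qed.

Lemma G_mul_gen x y :
  gop G_law (G_gen x) (G_gen y) = gop G_law (G_gen (L x y)) (G_gen (R y x)).
Proof.
by rewrite !G_opE; apply/pres_piP/pres_relator; exists x, y.
Qed.

(* Xbar and image_map are the image of X in a quotient of the skew left brace G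
   and the restriction to it of the associated solution of the quotient. *)
Section Image.
Variables (I : set structure_brace) (idI : ideal I).

Definition Xbar : set (quot_brace idI) :=
  [set z | exists x : S, z = quot_pi idI (G_gen x)].

Lemma quot_map_gen x y :
  sb_map (B := quot_brace idI) (quot_pi idI (G_gen x), quot_pi idI (G_gen y)) =
  (quot_pi idI (G_gen (L x y)), quot_pi idI (G_gen (R y x))).
Proof.
have lE : sb_lam (B := quot_brace idI)
    (quot_pi idI (G_gen x)) (quot_pi idI (G_gen y)) = quot_pi idI (G_gen (L x y)).
  by rewrite /sb_lam quot_oppE quot_circE quot_addE -G_lam_gen.
rewrite /sb_map lE -(gopA (sb_circ (quot_brace idI))) quot_circVE !quot_circE.
congr (_, quot_pi idI _); apply: (@gop_injl _ G_law (G_gen (L x y))).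
by rewrite -G_mul_gen; apply: (gopKV G_law).
Qed.

Lemma Xbar_stable a b : Xbar a -> Xbar b ->
  Xbar (sb_map (a, b)).1 /\ Xbar (sb_map (a, b)).2.
Proof.
move=> [x ->] [y ->]; rewrite quot_map_gen.
by split; [exists (L x y) | exists (R y x)].
Qed.

Definition image_car : Type := {z : quot_brace idI | Xbar z}.

Definition image_map (p : image_car * image_car) : image_car * image_car :=
  let st := Xbar_stable (proj2_sig p.1) (proj2_sig p.2) in
  (exist _ _ (proj1 st), exist _ _ (proj2 st)).

End Image.
End StructureGroup.

Arguments comm_add : clear implicits.
Arguments G_law : clear implicits.
Arguments image_map [S I] idI p.

(* Main.v *)
(* The abelianization M of (G, +) is free abelian on the orbits of X under
   conjugation in A_gr(X, r), and (G, o) permutes this basis through lambda.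
   Since the permutations in question are finitely many, a pigeonhole argument
   gives, for each y in X, some n > 0 and some h in G that acts trivially on X
   and has image n y in M.  Commuting h repeatedly with g in (G, o) replaces
   this image v by v - g v, so nilpotency of (G, o) yields (1 - g)^k (n y) = 0.
   As g acts with finite order and M is torsion-free, g fixes the image of y.
   Hence lambda acts trivially on M, so that [G, G]_+ is an ideal and a o b
   agrees with a + b modulo it. *)
Require Import Defs.
From mathcomp Require Import all_boot ssralg ssrnum ssrint perm fingroup.
From mathcomp Require Import boolp classical_sets.

Set Implicit Arguments.
Unset Strict Implicit.
Unset Printing Implicit Defensive.

(** * Commutator subgroups *)

Section CommutatorSubgroup.
Variables (T : Type) (L : group_law T).
Local Notation "x * y" := (gop L x y).
Local Notation "x ^-1" := (ginv L x).

Lemma commutators_subgroup (H K : set T) : subgroup L (commutators L H K).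
Proof.
split=> [|x y hx hy|x hx] U UP; have [[U1 UM UV] _] := UP; first exact: U1.
  exact: UM (hx U UP) (hy U UP).
exact: UV (hx U UP).
Qed.

Lemma mem_commutators (H K : set T) x y :
  H x -> K y -> commutators L H K (x * y * x^-1 * y^-1).
Proof. by move=> hx hy U [_ sU]; apply: sU; exists x, y. Qed.

(** Conjugation changes h only by a commutator: g h g^-1 = [g, h] h. *)
Lemma derived_normal : normal_subgroup L (commutators L setT setT).
Proof.
have [_ IM _] := commutators_subgroup setT setT.
split=> [|g h hh]; first exact: commutators_subgroup.
have -> : g * h * g^-1 = g * h * g^-1 * h^-1 * h.
  by rewrite -[RHS](gopA L) (ginvl L) gidr.
by apply: (IM) => //; apply: mem_commutators.
Qed.

(** The element is the commutator of y^-1 and x^-1. *)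
Lemma derived_comm x y : commutators L setT setT ((x * y)^-1 * (y * x)).
Proof.
have := @mem_commutators setT setT (y^-1) (x^-1) I I.
by rewrite !ginvK ginvM -!(gopA L).
Qed.

Lemma gmorph1 (f : T -> T) : {morph f : x y / x * y} -> f (gid L) = gid L.
Proof.
by move=> fM; apply: (@gop_injl _ L (f (gid L))); rewrite -fM (gidl L) gidr.
Qed.

Lemma gmorphV (f : T -> T) : {morph f : x y / x * y} -> {morph f : x / x^-1}.
Proof. by move=> fM x; apply: ginv_uniq; rewrite -fM ginvr gmorph1. Qed.

(** The preimage of the derived subgroup under f is a subgroup containing all commutators. *)
Lemma derived_morph (f : T -> T) : {morph f : x y / x * y} ->
  forall x, commutators L setT setT x -> commutators L setT setT (f x).
Proof.
move=> fM x hx; have [I1 IM IV] := commutators_subgroup setT setT.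
have f1 := gmorph1 fM; have fV := gmorphV fM.
refine (hx (fun y => commutators L setT setT (f y)) _); split.
  by split=> [|y z hy hz|y hy]; rewrite /= ?f1 ?fM ?fV; auto.
by move=> _ [y [z [_ _ ->]]]; rewrite /= !fM !fV; apply: mem_commutators.
Qed.

End CommutatorSubgroup.

Arguments derived_comm {T} L x y.
Arguments derived_morph {T L f} fM [x] hx.

(** * Skew left braces whose lambda acts trivially on the abelianized additive group *)

Section TrivialAbelianization.
Variable B : skew_brace.
Local Notation "x + y" := (gop (sb_add B) x y).
Local Notation "- x" := (ginv (sb_add B) x).
Local Notation "0" := (gid (sb_add B)).
Local Notation "x * y" := (gop (sb_circ B) x y).
Local Notation "x ^-1" := (ginv (sb_circ B) x).
Local Notation D := (commutators (sb_add B) setT setT).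

Lemma sb_lamD a : {morph sb_lam a : b c / b + c}.
Proof. by move=> b c; rewrite /sb_lam sb_ax -!(gopA (sb_add B)). Qed.

Lemma sb_lam0 a : sb_lam a 0 = 0.
Proof. exact/gmorph1/sb_lamD. Qed.

Lemma sb_lamN a : {morph sb_lam a : b / - b}.
Proof. exact/gmorphV/sb_lamD. Qed.

Hypothesis lam_triv : forall a b, D (- b + sb_lam a b).

Let D_op := normal_op (derived_normal (sb_add B)).

Lemma derived_refl a : D (- a + a).
Proof. by rewrite ginvl; have [] := commutators_subgroup (sb_add B) setT setT. Qed.
Arguments derived_refl : clear implicits.

Lemma derived_addcirc a b : D (- (a + b) + a * b).
Proof. by rewrite sb_lamE; apply: D_op; [apply: derived_refl|]. Qed.

Lemma derived_ideal : ideal D.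
Proof.
have Dsub := commutators_subgroup (sb_add B) setT setT.
have [D0 DD DN] := Dsub.
have DL a b : D b -> D (sb_lam a b).
  exact: (@derived_morph _ _ _ (sb_lamD a) b).
have DM a b : D a -> D b -> D (a * b).
  by move=> ha hb; rewrite sb_lamE; exact: (DD _ _ ha (DL _ _ hb)).
have DV a : D a -> D a^-1.
  (* Indeed a^-1 + lambda_(a^-1)(a) = a^-1 o a = 0. *)
  move=> ha; suff -> : a^-1 = - sb_lam a^-1 a by exact: (DN _ (DL _ _ ha)).
  rewrite -[RHS](gidl (sb_add B)) -sb_id -{1}(ginvl (sb_circ B) a) sb_lamE.
  by rewrite -(gopA (sb_add B)) ginvr gidr.
split=> //; first exact: derived_normal.
split=> [|g h hh]; first by split; rewrite ?sb_id.
(* Normality in (B, o): modulo D, g o h o g^-1 is g + h + g^-1, and g + g^-1 lies in D because g o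
   g^-1 = 0. [E] carries membership in D along congruences modulo D. *)
have E x y : D (- x + y) -> D x -> D y.
  by move=> h1 hx; have := DD _ _ hx h1; rewrite gopKV.
apply: (E _ _ (derived_addcirc (g * h) g^-1)).
have hgg : D (g + g^-1).
  by have := derived_addcirc g g^-1; rewrite ginvr sb_id gidr => /DN; rewrite ginvK.
apply: (E _ _ (D_op (derived_addcirc g h) (derived_refl g^-1))).
rewrite -(gopA (sb_add B)).
apply: (E _ _ (D_op (derived_refl g) (derived_comm (sb_add B) g^-1 h))).
by rewrite (gopA (sb_add B)); exact: (DD _ _ hgg hh).
Qed.

Lemma quot_derived_trivial (idI : ideal D) : trivial_left_brace (quot_brace idI).
Proof.
split=> x y; rewrite -[x](quot_reprK (idI := idI)) -[y](quot_reprK (idI := idI)).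
  by rewrite !quot_addE; apply/quot_piP; exact: derived_comm.
by rewrite quot_addE quot_circE; apply/quot_piP; exact: derived_addcirc.
Qed.

End TrivialAbelianization.

(** * Unipotent operators of finite order on integer functions *)

Section FiniteOrderDifference.
Import GRing.Theory Num.Theory.
Local Open Scope ring_scope.
Variables (T : finType) (tau : T -> T).
Hypothesis tau_inj : injective tau.

Definition shift_diff (v : T -> int) (p : T) : int := v p - v (tau p).

Lemma finite_order_iter : exists2 m, (0 < m)%N & forall p, iter m tau p = p.
Proof.
exists #[perm tau_inj]%g; first exact: order_gt0.
move=> p; rewrite -[RHS](perm1 p) -(expg_order (perm tau_inj)) permX.
by apply: eq_iter => q; rewrite permE.
Qed.

(** The exponent drops one at a time: if two differences kill w, then w decreases by a constant d at
    each step of a [tau]-orbit; returning to the start after m > 0 steps forces m d = 0, hence d =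
    0. *)
Lemma shift_diff_nilpotent n (v : T -> int) :
  (forall p, iter n.+1 shift_diff v p = 0) -> forall p, shift_diff v p = 0.
Proof.
elim: n => [//|n IH] h; apply: IH => /=; set w := iter n _ v.
have Dinv p : shift_diff w (tau p) = shift_diff w p.
  by apply/esym/eqP; rewrite -subr_eq0; apply/eqP/(h p).
have wE k p : w (iter k tau p) = w p - shift_diff w p *+ k.
  elim: k => [|k IHk]; first by rewrite mulr0n subr0.
  have Dk j : shift_diff w (iter j tau p) = shift_diff w p.
    by elim: j => //= j <-; apply: Dinv.
  rewrite mulrSr opprD addrA -IHk -(Dk k) /shift_diff /=.
  by rewrite opprB addrC subrK.
have [m m0 mE] := finite_order_iter.
move=> p; apply/eqP; have /eqP := wE m p.
rewrite mE eq_sym -subr_eq0 addrAC subrr add0r oppr_eq0 mulrn_eq0.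
by rewrite eqn0Ngt m0.
Qed.

End FiniteOrderDifference.

(** * The action of the structure group on X and on the classes of generators *)

Section StructureGroupAction.
Import GRing.Theory Num.Theory.
Local Open Scope ring_scope.
Variable S : finite_solution.
Local Notation r := (@sol_map S).
Local Notation "x ** y" := (gop (G_law S) x y) (at level 40, left associativity).
Local Notation "x ^-1" := (ginv (G_law S) x).
Local Notation GB := (structure_brace S).
Local Notation I := (comm_add S).

(** The choice of word is immaterial, since [word_act] respects the relations of G. *)
Definition gact (g : GB) : S -> S := word_act (pres_repr g).

Lemma gactM g h y : gact (g ** h) y = gact g (gact h y).
Proof.
by rewrite /gact (word_act_eq (pres_repr_pi (@G_rel S) _)) word_act_cat.
Qed.

Lemma gact1 y : gact (gid (G_law S)) y = y.
Proof. exact: (word_act_eq (pres_repr_pi (@G_rel S) [::])). Qed.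

Lemma gactK g : cancel (gact g) (gact g^-1).
Proof. by move=> y; rewrite -gactM ginvl gact1. Qed.

Lemma gactVK g : cancel (gact g^-1) (gact g).
Proof. by move=> y; rewrite -gactM ginvr gact1. Qed.

Lemma sb_lam_cocycle (g b : GB) : cocycle (sb_lam g b) = G_act g (cocycle b).
Proof.
apply: (@gop_injl _ (A_law S) (cocycle g)).
by rewrite -cocycleM -cocycleD; congr cocycle; exact: (esym (sb_lamE g b)).
Qed.

Lemma sb_lam_gen (g : GB) y : sb_lam g (G_gen y : GB) = G_gen (gact g y).
Proof.
apply: (can_inj (@cocycleK S)); rewrite sb_lam_cocycle !cocycle_gen.
by rewrite -[in LHS](pres_reprK g) G_actE.
Qed.

(** Through the cocycle, (G, +) is the group presented by [A_rel], so each element is a sum of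
    generators and their opposites. *)
Lemma gen_ind (H : set GB) : subgroup (sb_add GB) H ->
  (forall x, H (G_gen x)) -> forall a, H a.
Proof.
move=> [H0 HD HN] Hgen a; rewrite -[a]cocycleK.
rewrite -[cocycle a]pres_reprK; elim: (pres_repr _) => [|[b x] w IH]; first exact: H0.
have -> : pres_pi (@A_rel S) ((b, x) :: w) =
    gop (A_law S) (pres_pi (@A_rel S) [:: (b, x)]) (pres_pi (@A_rel S) w).
  by rewrite A_opE.
rewrite -[X in gop _ X _]cocycleVK -[X in gop _ _ X]cocycleVK.
apply: (HD _ _ _ IH).
suff HT : H (cocycleV (pres_pi (@A_rel S) [:: (true, x)])).
  case: b => //.
  have -> : pres_pi (@A_rel S) [:: (false, x)] =
      ginv (A_law S) (pres_pi (@A_rel S) [:: (true, x)]).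
    by apply: ginv_uniq; rewrite A_opE; apply/pres_piP/(pres_cancel _ true).
  rewrite -[X in ginv _ X]cocycleVK; exact: HN.
by have := cocycleK (G_gen x); rewrite cocycle_gen => ->.
Qed.

(* The equivalence relation on X whose classes form the basis of the abelianization
   of (G, +). *)
Definition ab_rel (x y : S) : bool :=
  `[< I (gop (sb_add GB) (ginv (sb_add GB) (G_gen x)) (G_gen y)) >].

Lemma ab_rel_refl x : ab_rel x x.
Proof. by apply/asboolP; apply: derived_refl. Qed.

Lemma ab_rel_sym x y : ab_rel x y -> ab_rel y x.
Proof.
have [_ _ IN] := commutators_subgroup (sb_add GB) setT setT.
by move=> /asboolP /IN; rewrite ginvM ginvK => h; apply/asboolP.
Qed.

Lemma ab_rel_trans x y z : ab_rel x y -> ab_rel y z -> ab_rel x z.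
Proof.
have [_ ID _] := commutators_subgroup (sb_add GB) setT setT.
move=> /asboolP h1 /asboolP h2; apply/asboolP; move: (ID _ _ h1 h2).
by rewrite -(gopA (sb_add GB)) gopKV.
Qed.

Lemma ab_rel_gact g x y : ab_rel x y -> ab_rel (gact g x) (gact g y).
Proof.
move=> /asboolP h; apply/asboolP.
by have := derived_morph (sb_lamD (B := GB) g) h; rewrite sb_lamD sb_lamN !sb_lam_gen.
Qed.

(** The relation x + u = u + x' of A exhibits x' as the conjugate -u + x + u of x. *)
Lemma ab_rel_relator x y :
  ab_rel x (lam r (lam r x y) (rho r y x)).
Proof.
set u := lam r x y; set x' := lam r u _.
apply/asboolP.
have E : gop (sb_add GB) (G_gen x) (G_gen u) = gop (sb_add GB) (G_gen u) (G_gen x').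
  apply: (can_inj (@cocycleK S)); rewrite !cocycleD !cocycle_gen !A_opE.
  by apply/pres_piP/pres_relator; exists x, y.
have -> : G_gen x' = gop (sb_add GB) (ginv (sb_add GB) (G_gen u))
    (gop (sb_add GB) (G_gen x) (G_gen u)).
  by rewrite E gopVK.
rewrite (gopA (sb_add GB)) -ginvM.
exact: derived_comm.
Qed.

(** * Integer coordinates on the abelianization, indexed by classes of generators *)

Definition class_count (p : S) (w : word S) : int :=
  \sum_(l <- w) (if l.1 then 1 else -1) * (ab_rel p l.2)%:R.

Lemma class_count_cat p u v :
  class_count p (u ++ v) = class_count p u + class_count p v.
Proof. exact: big_cat. Qed.

Lemma class_count1 p l :
  class_count p [:: l] = (if l.1 then 1 else -1) * (ab_rel p l.2)%:R.
Proof. exact: big_seq1. Qed.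

(** In a relator x + u = u + x' the letters x and x' are in the same class, so both sides have the
    same signed count. *)
Lemma class_count_eq p u v :
  pres_eq (@A_rel S) u v -> class_count p u = class_count p v.
Proof.
elim=> {u v} //.
- by move=> u v w _ -> _ ->.
- by move=> u u' v v' _ IH1 _ IH2; rewrite !class_count_cat IH1 IH2.
- move=> b x; rewrite -cat1s class_count_cat !class_count1 /class_count big_nil.
  by case: b; rewrite /= mul1r mulN1r ?subrr ?addNr.
- move=> _ _ [x [y [-> ->]]]; rewrite -cat1s -[in RHS]cat1s !class_count_cat.
  rewrite addrC; congr (_ + _); rewrite !class_count1 /=; congr (_ * (nat_of_bool _)%:R).
  have xx' := ab_rel_relator x y; apply/idP/idP => h.
    exact: ab_rel_trans xx'.
  exact/(ab_rel_trans h)/ab_rel_sym.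
Qed.

(** The action preserves [ab_rel], so p ~ g x exactly when g^-1 p ~ x. *)
Lemma class_count_map g p w :
  class_count p (word_map (gact g) w) = class_count (gact g^-1 p) w.
Proof.
rewrite /class_count big_map; apply: eq_bigr => -[b x] _ /=; congr (_ * (nat_of_bool _)%:R).
apply/idP/idP => [/(ab_rel_gact g^-1)|/(ab_rel_gact g)].
  by rewrite gactK.
by rewrite gactVK.
Qed.

Definition ab_coord (g : GB) (p : S) : int :=
  class_count p (pres_repr (cocycle g)).

Lemma ab_coord_cocycle g p w :
  cocycle g = pres_pi (@A_rel S) w -> ab_coord g p = class_count p w.
Proof. by rewrite /ab_coord => ->; apply/class_count_eq/pres_repr_pi. Qed.

(** This is the cocycle identity in coordinates; g acts on coordinate functions by precomposition
    with g^-1. *)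
Lemma ab_coordM g h p :
  ab_coord (g ** h) p = ab_coord g p + ab_coord h (gact g^-1 p).
Proof.
rewrite (@ab_coord_cocycle _ _ (pres_repr (cocycle g) ++
    word_map (gact g) (pres_repr (cocycle h)))).
  by rewrite class_count_cat class_count_map.
by rewrite cocycleM -A_opE pres_reprK.
Qed.

Lemma ab_coord1 p : ab_coord (gid (G_law S)) p = 0.
Proof.
rewrite (@ab_coord_cocycle _ _ [::]) /class_count ?big_nil //.
exact: cocycleE.
Qed.

(** * From nilpotency to a trivial action on the abelianization *)

Lemma kernel_multiple y : exists n h, [/\ (0 < n)%N, gact h =1 id
  & forall p, ab_coord h p = (ab_rel p y)%:R *+ n].
Proof.
(* [gam k] is the k-fold sum of the generator y in (G, +). *)
pose gam k : GB := cocycleV (pres_pi (@A_rel S) (nseq k (true, y))).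
have gamE k p : ab_coord (gam k) p = (ab_rel p y)%:R *+ k.
  rewrite (@ab_coord_cocycle _ _ (nseq k (true, y))) ?cocycleVK //.
  elim: k => [|k IH]; first by rewrite /class_count big_nil.
  rewrite -[nseq k.+1 _]/([:: (true, y)] ++ nseq k _) class_count_cat IH.
  by rewrite class_count1 mul1r mulrS.
(* There is one more index than there are maps from X to X, so two of the [gam k] act alike. *)
pose act (k : 'I_#|{ffun S -> S}|.+1) := [ffun x => gact (gam k) x].
have /injectivePn [i [j]] : ~~ injectiveb act.
  by apply/negP => /injectiveP /leq_card; rewrite card_ord ltnn.
wlog ij : i j / (i < j)%N => [hw|_].
  move=> ne /[dup] E; have : (i : nat) != j by [].
  rewrite neq_ltn => /orP[ij|ji] _; first exact: hw ij ne E.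
  by apply: hw ji _ (esym E); rewrite eq_sym.
move=> /ffunP E; exists (j - i)%N, (gam j ** (gam i)^-1).
have actV x : gact (gam j ** (gam i)^-1) x = x.
  rewrite gactM; have := E (gact (gam i)^-1 x); rewrite !ffunE => <-.
  exact: gactVK.
split=> [||p] //; first by rewrite subn_gt0.
(* With h = [gam j] o [gam i]^-1 acting trivially, h o [gam i] = [gam j] makes the coordinates of h
   those of [gam j] minus those of [gam i]. *)
have := ab_coordM (gam j ** (gam i)^-1) (gam i) p.
rewrite -(gopA (G_law S)) ginvl gidr !gamE.
have -> : gact (gam j ** (gam i)^-1)^-1 p = p by rewrite -{1}[p]actV gactK.
by rewrite mulrnBr ?(ltnW ij) // => ->; rewrite addrK.
Qed.

Lemma iter_commutator g h k : gact h =1 id ->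
  exists c, [/\ lower_central (G_law S) k c, gact c =1 id
    & forall p, ab_coord c p = iter k (shift_diff (gact g^-1)) (ab_coord h) p].
Proof.
move=> hid; elim: k => [|k [c [ck cid cE]]]; first by exists h.
have Vid a : gact a =1 id -> gact a^-1 =1 id.
  by move=> aid x; rewrite -{1}[x]aid gactK.
exists (c ** g ** c^-1 ** g^-1); have did : gact (c ** g ** c^-1 ** g^-1) =1 id.
  by move=> x; rewrite !gactM cid Vid // gactVK.
split=> // [|p]; first exact: mem_commutators.
rewrite iterS /shift_diff -!cE.
(* Comparing the coordinates of both sides of d o g o c = c o g, where d = [c, g] and c act
   trivially, gives those of d as v - g v, with v those of c; no coordinates of inverses are
   needed. *)
have : c ** g ** c^-1 ** g^-1 ** (g ** c) = c ** g.
  by rewrite -!(gopA (G_law S)) gopVK ginvl gidr.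
move: (c ** g ** c^-1 ** g^-1) did => d did /(congr1 (ab_coord^~ p)) /=.
rewrite !ab_coordM !(Vid d, Vid c) // [ab_coord g p + _]addrC addrA.
by move=> /addIr <-; rewrite addrK.
Qed.

Lemma nilpotent_ab_rel : nilpotent_law (G_law S) ->
  forall g y, ab_rel y (gact g y).
Proof.
case=> N nilN g y; have [n [h [n0 hid hE]]] := kernel_multiple y.
have gV_inj : injective (gact g^-1) := can_inj (gactVK g).
have [c [cN _ cE]] := iter_commutator g N hid.
have c1 : c = gid (G_law S) by move: cN; rewrite nilN.
have v0 p : iter N (shift_diff (gact g^-1)) (ab_coord h) p = 0.
  by rewrite -cE c1 ab_coord1.
(* [shift_diff_nilpotent] asks for a positive exponent, while N may be 0. *)
have v1 p : iter N.+1 (shift_diff (gact g^-1)) (ab_coord h) p = 0.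
  by rewrite iterS /shift_diff !v0 subrr.
(* At the point g y the vanishing difference is n times the indicator of g y ~ y minus that of y ~
   y; since n > 0 and the latter is 1, so is the former. *)
have /eqP := shift_diff_nilpotent gV_inj v1 (gact g y).
rewrite /shift_diff gactK !hE ab_rel_refl -mulrnBl mulrn_eq0 eqn0Ngt n0 /=.
by move=> E; apply: ab_rel_sym; case: (ab_rel _ y) E.
Qed.

(** For fixed a, the elements b satisfying the claim form a subgroup of (G, +), because lambda_a is
    additive and the derived subgroup is normal; this leaves only the generators. *)
Lemma nilpotent_lam_triv : nilpotent_law (G_law S) ->
  forall a b : GB, I (gop (sb_add GB) (ginv (sb_add GB) b) (sb_lam a b)).
Proof.
move=> nilG a; pose H : set GB := fun b =>
  I (gop (sb_add GB) (ginv (sb_add GB) b) (sb_lam a b)).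
apply: (gen_ind (H := H)) => [|x].
  have nI := derived_normal (sb_add GB); split=> [|b c hb hc|b hb]; rewrite /H.
  - by rewrite sb_lam0; apply: derived_refl.
  - by rewrite sb_lamD; apply: (normal_op nI).
  - by rewrite sb_lamN; apply: (normal_inv nI).
by rewrite /H sb_lam_gen; apply/asboolP/nilpotent_ab_rel.
Qed.

End StructureGroupAction.

(** * Trivial solutions and the conclusion *)

Lemma trivial_map_solution (X : Type) (r : X * X -> X * X) :
  inhabited X -> is_trivial_map r -> is_solution r.
Proof.
move=> X0 rE; have lE x y : lam r x y = y by rewrite /lam rE.
have rhoE x y : rho r y x = x by rewrite /rho rE.
split=> // [|x|y|[[x y] z]].
- by exists r => -[x y]; rewrite !rE.
- by exists id => y; rewrite lE.
- by exists id => x; rewrite rhoE.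
- by rewrite /r_x_id /id_x_r /=; do !rewrite rE /=.
Qed.

(** Here lambda_a(b) = -a + (a + b) = b, and commutativity gives b^-1 o a o b = a. *)
Lemma trivial_brace_map (B : skew_brace) : trivial_left_brace B ->
  is_trivial_map (@sb_map B).
Proof.
move=> [addC addE] a b; have lE : sb_lam a b = b.
  by rewrite /sb_lam -addE gopVK.
by rewrite /sb_map lE -(gopA (sb_circ B)) -(addE a) addC addE gopVK.
Qed.

Theorem corollary4p18 (S : finite_solution) :
  multipermutation S ->
  nilpotent_law (G_law S) ->
  exists idI : ideal (comm_add S),
    trivial_left_brace (quot_brace idI) /\
    (is_solution (image_map idI) /\ is_trivial_map (image_map idI)).
Proof.
move=> _ /nilpotent_lam_triv lam_triv.
exists (derived_ideal lam_triv).
have trivQ := quot_derived_trivial lam_triv (derived_ideal lam_triv).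
have trivI : is_trivial_map (image_map (derived_ideal lam_triv)).
  move=> [a ha] [b hb]; have rE := trivial_brace_map trivQ a b.
  (* Points of the image carry a membership proof; proof irrelevance reduces equality to the
     underlying elements of the quotient. *)
  by congr (_, _); apply: eq_exist; [exact: (congr1 fst rE) | exact: (congr1 snd rE)].
split=> //; split=> //; apply: trivial_map_solution => //.
have [x] := sol_nonempty (sol_prop S).
by constructor; exists (quot_pi (derived_ideal lam_triv) (G_gen x)), x.
Qed.
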